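(* Let $\Gamma_{\mathrm{DTE}}=(R,A,U)$ be the game in which the players are the robots $R=\{r_1,\dots,r_n\}$, the action set of robot $r_i$ is a minimal action set $A_i\subseteq\mathbf{P}_i$ (as defined in the context), $A=A_1\times\cdots\times A_n$, and the utilities are $U_i(\mathbf{p})=\sum_{\tau_j\in\tau}\left[v_j(\mathbf{c}_j(\mathbf{p}))-v_j(\mathbf{c}_j(\mathbf{p}_{-i}))\right]$. For a system with $n$ robots and $m$ tasks, if there is only one station (so all robots have the same station, $\sigma_1=\cdots=\sigma_n$) and all the tasks are simple, then $$\mathrm{PoA}(\Gamma_{\mathrm{DTE}})\ \le\ \max\left(\frac{m}{n},\,1\right).$$
   Context: **Environment and trajectories.** $P=\{1,\dots,\bar x\}\times\{1,\dots,\bar y\}$ with $\bar x,\bar y\in\mathbb{Z}_+$ is a grid, $P_F\subseteq P$ is the set of feasible cells, and $S\subseteq P_F$ is the set of station cells. For $p=(x,y)\in P_F$, $N(p)=\{(x',y')\in P_F: |x'-x|\le 1,\ |y'-y|\le 1\}$. There are $n$ robots $R=\{r_1,\dots,r_n\}$; robot $r_i$ is assigned a station $\sigma_i\in S$. With $T\in\mathbb{Z}_+$ the episode length, the set of feasible trajectories of $r_i$ is $\mathbf{P}_i=\{\mathbf{p}_i=(p_i^0,\dots,p_i^T): p_i^0=p_i^T=\sigma_i,\ p_i^{t+1}\in N(p_i^t)\ \forall t<T\}$, and $\mathbf{P}=\mathbf{P}_1\times\cdots\times\mathbf{P}_n$. **Tasks.** $\tau=\{\tau_1,\dots,\tau_m\}$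 is a finite set of tasks, $\tau_j=(\ell_j,t^a_j,t^d_j,v_j)$, with location $\ell_j\in P_F$, arrival and departure times $t^a_j<t^d_j$ in $\{0,\dots,T\}$, and value function $v_j$. Tasks at the same location have non-overlapping windows: if $i\ne j$ and $\ell_i=\ell_j$ then $\min\{t^d_i,t^d_j\}\le\max\{t^a_i,t^a_j\}$. For $\mathbf{p}\in\mathbf{P}$, $c_j(\mathbf{p},t)=|\{r_k\in R: p_k^t=p_k^{t+1}=\ell_j\}|$ and $\mathbf{c}_j(\mathbf{p})=[c_j(\mathbf{p},t^a_j),\dots,c_j(\mathbf{p},t^d_j-1)]^{\mathsf T}$. The vector $\mathbf{c}_j(\mathbf{p}_{-i})$ is defined in the same way but counting only robots in $R\setminus\{r_i\}$. The function $v_j$ maps such count vectors to $[0,\bar v_j]$, where $\bar v_j>0$ is the maximum value of the task. The total value is $f(\mathbf{p})=\sum_{\tau_j\in\tau}v_j(\mathbf{c}_j(\mathbf{p}))$. **Simple task.** A task $\tau_j$ is simple if it can be completed by one robot in one time step, i.e. $v_j(\mathbf{c}_j(\mathbf{p}))=\bar v_j$ if $\max(\mathbf{c}_j(\mathbf{p}))\ge 1$ (some entry of the count vector is at least $1$), and $v_j(\mathbf{c}_j(\mathbf{p}))=0$ otherwise (the same rule applies to $\mathbf{c}_j(\mathbf{p}_{-i})$). **Minimal action sets.** For $\mathbf{q}_i\in\mathbf{P}_i$ let $t^*(\mathbf{q}_i,\tau)=\{t: \exists\,\tau_j\in\tau,\ q_i^t=q_i^{t+1}=\ell_j,\ t^a_j\le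 t<t^d_j\}$. The action set $A_i$ is a minimum-cardinality set among all nonempty $A_i'\subseteq\mathbf{P}_i$ satisfying: for every $\mathbf{q}_i\in\mathbf{P}_i\setminus A_i'$ there is $\mathbf{p}_i\in A_i'$ such that $p_i^t=p_i^{t+1}=q_i^t$ for all $t\in t^*(\mathbf{q}_i,\tau)$. **Nash equilibria and price of anarchy.** $\mathbf{p}^*\in A$ is a Nash equilibrium if $U_i(\mathbf{p}^*_i,\mathbf{p}^*_{-i})=\max_{\mathbf{p}_i\in A_i}U_i(\mathbf{p}_i,\mathbf{p}^*_{-i})$ for all $i$. With $A^*\subseteq A$ the set of Nash equilibria, $\mathrm{PoA}(\Gamma_{\mathrm{DTE}})=\max_{\mathbf{p}\in A^*}f(\mathbf{p})\,/\min_{\mathbf{p}\in A^*}f(\mathbf{p})$ (the potential function of the game is $f$). If the denominator is $0$ and the numerator is positive, PoA is $+\infty$; if both are $0$, PoA is $1$. *)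

(* Defs.v *)
From HB Require Import structures.
From mathcomp Require Import all_boot all_order all_algebra.
From mathcomp Require Import constructive_ereal reals.

Set Implicit Arguments.
Unset Strict Implicit.
Unset Printing Implicit Defensive.

Import Order.TTheory GRing.Theory Num.Theory.
Local Open Scope ring_scope.

Section Games.
Variables (R : realType) (n : nat) (X : finType).

Definition profile := {ffun 'I_n -> X}.

Implicit Types (A : 'I_n -> {set X}) (U : 'I_n -> profile -> R) (p : profile).

Definition profiles A : {set profile} := [set p : profile | [forall i, p i \in A i]].

(* (a, p_{-i}) *)
Definition deviate (i : 'I_n) (a : X) p : profile :=
  [ffun k => if k == i then a else p k].

Definition nash A U : {set profile} :=
  [set p : profile | p \in profiles A &
    [forall i, forall a in A i, U i (deviate i a p) <= U i p]].

(* The maximum and the minimum over E are computed in \bar R, where -oo and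
   +oo are neutral for them; they are the genuine ones when E is nonempty. *)
Definition price_of_anarchy (E : {set profile}) (f : profile -> R) : \bar R :=
  (let best := \big[Order.max/-oo]_(p in E) (f p)%:E in
   let worst := \big[Order.min/+oo]_(p in E) (f p)%:E in
   if worst == 0 then (if best == 0 then 1 else +oo) else best / worst)%E.

End Games.

(* The grid {1..X} x {1..Y}, with coordinates shifted to start from 0. *)
Definition cell (X Y : nat) : finType := ('I_X * 'I_Y)%type.

(* Count vectors have entries indexed by arrival, ..., departure - 1. *)
Record task (R : realType) (X Y T : nat) := Task {
  location : cell X Y;
  arrival : nat;
  departure : nat;
  arrival_lt_departure : (arrival < departure)%N;
  departure_le_horizon : (departure <= T)%N;
  max_value : R;
  max_value_gt0 : 0 < max_value;
  value : (departure - arrival).-tuple nat -> R;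
  value_range : forall c, 0 <= value c <= max_value
}.

Record dte_system (R : realType) (n m : nat) := DTESystem {
  xbar : nat;
  ybar : nat;
  free : {set cell xbar ybar};
  stations : {set cell xbar ybar};
  stations_free : stations \subset free;
  station : 'I_n -> cell xbar ybar;
  station_in : forall i, station i \in stations;
  horizon : nat;
  tasks : 'I_m -> task R xbar ybar horizon;
  location_free : forall j, location (tasks j) \in free;
  windows_disjoint : forall i j, i != j ->
    location (tasks i) = location (tasks j) ->
    (minn (departure (tasks i)) (departure (tasks j))
      <= maxn (arrival (tasks i)) (arrival (tasks j)))%N
}.

Section System.
Variables (R : realType) (n m : nat) (G : dte_system R n m).

Local Notation T := (horizon G).
Local Notation loc j := (location (tasks G j)).
Local Notation ta j := (arrival (tasks G j)).
Local Notation td j := (departure (tasks G j)).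

Definition gcell : finType := cell (xbar G) (ybar G).

Definition neighborhood (c : gcell) : {set gcell} :=
  [set d in free G |
    (`|(d.1 : nat)%:Z - (c.1 : nat)%:Z| <= 1) &&
    (`|(d.2 : nat)%:Z - (c.2 : nat)%:Z| <= 1)].

Definition trajectory : finType := {ffun 'I_T.+1 -> gcell}.

(* Only used at times t <= T, where inord t has value t. *)
Definition at_time (p : trajectory) (t : nat) : gcell := p (inord t).

Definition feasible (i : 'I_n) : {set trajectory} :=
  [set p : trajectory |
    [&& at_time p 0 == station G i, at_time p T == station G i &
      [forall t : 'I_T, at_time p t.+1 \in neighborhood (at_time p t)]]].

Definition stays (p : trajectory) (t : nat) (c : gcell) : bool :=
  (at_time p t == c) && (at_time p t.+1 == c).

Definition count (K : {set 'I_n}) (p : profile n trajectory) (j : 'I_m)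
    (t : nat) : nat :=
  #|[set k in K | stays (p k) t (loc j)]|.

(* K = [set: 'I_n] gives c_j(p), and K = [set~ i] gives c_j(p_{-i}). *)
Definition counts (K : {set 'I_n}) (p : profile n trajectory) (j : 'I_m) :
    (td j - ta j).-tuple nat :=
  [tuple count K p j (ta j + s) | s < td j - ta j].

Definition task_value (K : {set 'I_n}) (p : profile n trajectory) (j : 'I_m) :
    R :=
  value (counts K p j).

Definition total_value (p : profile n trajectory) : R :=
  \sum_(j < m) task_value [set: 'I_n] p j.

Definition utility (i : 'I_n) (p : profile n trajectory) : R :=
  \sum_(j < m) (task_value [set: 'I_n] p j - task_value [set~ i] p j).

Definition simple (j : 'I_m) : Prop :=
  let one_suffices K p :=
    task_value K p j =
      if (1 <= \max_(c <- counts K p j) c)%N then max_value (tasks G j) else 0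
  in forall p, p \in profiles feasible ->
     one_suffices [set: 'I_n] p /\ forall i, one_suffices [set~ i] p.

Definition service_times (q : trajectory) : {set 'I_T} :=
  [set t : 'I_T | [exists j, stays q t (loc j) && (ta j <= t < td j)%N]].

Definition covering (i : 'I_n) (B : {set trajectory}) : Prop :=
  [/\ B != set0, B \subset feasible i &
      forall q, q \in feasible i :\: B ->
        exists2 p, p \in B &
          forall t, t \in service_times q -> stays p t (at_time q t)].

Definition minimal_action_set (i : 'I_n) (B : {set trajectory}) : Prop :=
  covering i B /\ forall B', covering i B' -> (#|B| <= #|B'|)%N.

Definition PoA_dte (A : 'I_n -> {set trajectory}) : \bar R :=
  price_of_anarchy (nash A utility) total_value.

(* The game has the potential total_value, so it has an equilibrium and the
   maximum and minimum in PoA_dte range over a nonempty set. *)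
Lemma nash_neq0 (A : 'I_n -> {set trajectory}) :
  (forall i, A i != set0) -> nash A utility != set0.
Proof.
move=> A0.
have [p0 Ap0] : exists p, p \in profiles A.
  have ne i : exists a, a \in A i by apply/set0Pn.
  exists [ffun i => xchoose (ne i)]; rewrite /profiles inE; apply/forallP => i.
  by rewrite ffunE; exact: xchooseP.
have [p Ap maxp] := @arg_maxP _ R _ p0 (mem (profiles A)) total_value Ap0.
apply/set0Pn; exists p; rewrite /nash inE; apply/andP; split; first exact: Ap.
apply/forallP => i; apply/forall_inP => a Aa.
have same j : task_value [set~ i] (deviate i a p) j = task_value [set~ i] p j.
  congr value; apply: eq_mktuple => s; apply: eq_card => k.
  by rewrite !inE ffunE; case: (k == i).
rewrite /utility !sumrB (eq_bigr _ (fun j _ => same j)) lerD2r.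
have {}Ap : p \in profiles A by exact: Ap.
apply: maxp; change (deviate i a p \in profiles A).
rewrite !inE in Ap *; apply/forallP => k; rewrite ffunE.
by case: eqP => [->//|_]; exact: (forallP Ap).
Qed.

End System.

(* Main.v *)
(** Let [p] be an equilibrium and suppose that another profile [q] completes a
    set [B] of tasks left undone by [p]. The station being common, every robot
    can replicate the trajectory completing a given [j] in [B], so the
    equilibrium condition gives [v_j <= U_i p] for all [i]. For simple tasks,
    [U_i p] is the value of the tasks completed by robot [i] alone, and these
    sets of tasks are disjoint. Hence [n * v_j <= f p]; moreover each of the [n]
    robots completes some task alone, so that [#|B| <= m - n]. Summing over [B],
    [n * f q <= n * f p + (m - n) * f p = m * f p]. *)
Require Import Defs.
From mathcomp Require Import all_boot all_order all_algebra.
From mathcomp Require Import constructive_ereal reals.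

Import Order.TTheory GRing.Theory Num.Theory.
Local Open Scope ring_scope.

Set Implicit Arguments.
Unset Strict Implicit.
Unset Printing Implicit Defensive.

(** Stating the bound without division covers a zero denominator: a worst value 0 forces the best
    value to be 0, and the price is then 1 by convention, hence the need for [1 <= r]. *)
Lemma price_of_anarchy_le (R : realType) (n : nat) (X : finType)
    (E : {set profile n X}) (f : profile n X -> R) (r : R) :
  E != set0 -> 1 <= r -> (forall p, p \in E -> 0 <= f p) ->
  (forall p q, p \in E -> q \in E -> f q <= r * f p) ->
  (price_of_anarchy E f <= r%:E)%E.
Proof.
case/set0Pn=> p0 Ep0 r_ge1 f_ge0 f_le; rewrite /price_of_anarchy.
rewrite (bigmax_eq_arg _ p0) // => [|p _]; last exact: leNye.
rewrite (bigmin_eq_arg _ p0) // => [|p _]; last exact: leey.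
case: arg_maxP => // b Eb _; case: arg_minP => // w Ew w_min.
rewrite !eqe; case: (eqVneq (f w) 0) => [fw0|fw_neq0].
  suff -> : f b = 0 by rewrite eqxx lee_fin.
  apply/eqP; rewrite eq_le f_ge0 // andbT.
  by have := f_le _ _ Ew Eb; rewrite fw0 mulr0.
rewrite inver (negPf fw_neq0) -EFinM lee_fin ler_pdivrMr ?f_le //.
by rewrite lt0r fw_neq0 f_ge0.
Qed.

Section SimpleTasks.
Variables (R : realType) (n m : nat) (G : dte_system R n m).
Hypothesis all_simple : forall j : 'I_m, simple G j.

Local Notation loc j := (location (tasks G j)).
Local Notation ta j := (arrival (tasks G j)).
Local Notation td j := (departure (tasks G j)).
Local Notation vmax j := (max_value (tasks G j)).
Local Notation feasible_profiles := (profiles (feasible G)).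

Implicit Types (K : {set 'I_n}) (p q : profile n (trajectory G)).

Definition serves (a : trajectory G) (j : 'I_m) : bool :=
  [exists s : 'I_(td j - ta j), stays a (ta j + s) (loc j)].

Definition completed K p : {set 'I_m} :=
  [set j | [exists k in K, serves (p k) j]].

Definition completed_alone (i : 'I_n) p : {set 'I_m} :=
  completed [set: 'I_n] p :\: completed [set~ i] p.

Lemma completedE K p j :
  (j \in completed K p) = (1 <= \max_(c <- counts K p j) c)%N.
Proof.
rewrite inE big_tuple; apply/exists_inP/idP => [[k Kk /existsP[s ks]]|].
  apply: leq_trans (leq_bigmax s); rewrite tnth_mktuple card_gt0.
  by apply/set0Pn; exists k; rewrite inE Kk.
rewrite lt0n => max_neq0.
have [s] : exists s, tnth (counts K p j) s != 0%N.
  apply/existsP; apply: contraNT max_neq0 => /existsPn c0.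
  by rewrite big1 // => s _; apply/eqP/negPn/c0.
rewrite tnth_mktuple -lt0n card_gt0 => /set0Pn[k]; rewrite inE => /andP[Kk ks].
by exists k => //; apply/existsP; exists s.
Qed.

Lemma total_valueE p : p \in feasible_profiles ->
  total_value p = \sum_(j in completed [set: 'I_n] p) vmax j.
Proof.
move=> Fp; rewrite big_mkcond; apply: eq_bigr => j _.
by rewrite completedE; case: (all_simple j Fp).
Qed.

Lemma completed_sub K K' p :
  K \subset K' -> completed K p \subset completed K' p.
Proof.
move=> sKK'; apply/subsetP => j; rewrite !inE => /exists_inP[k Kk kj].
by apply/exists_inP; exists k => //; apply: (subsetP sKK').
Qed.

(** A task completed by the others is also completed by all, so its two values cancel; any other
    task contributes its full value or 0. *)
Lemma utilityE i p : p \in feasible_profiles ->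
  utility i p = \sum_(j in completed_alone i p) vmax j.
Proof.
move=> Fp; rewrite big_mkcond; apply: eq_bigr => j _.
have [-> /(_ i)->] := all_simple j Fp.
rewrite -!completedE in_setD.
have /subsetP/(_ j) := @completed_sub [set~ i] setT p (subsetT _).
case: (j \in completed [set~ i] p) => [->|_] //=; first by rewrite subrr.
by case: ifP; rewrite subr0.
Qed.

(** Some robot serves a common task [j]. It must be [k], since [j] is not completed without [k]; but
    then [j] is completed without [i]. *)
Lemma completed_alone_disjoint p i k : i != k ->
  [disjoint completed_alone i p & completed_alone k p].
Proof.
move=> neq_ik; rewrite -setI_eq0; apply/eqP/setP => j; rewrite !in_setI.
rewrite !in_setD in_set0; apply/negP => /andP[/andP[ij jT] /andP[kj _]].
move: jT; rewrite inE => /exists_inP[l _ lj]; move: kj.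
rewrite inE => /exists_inP; apply; exists l => //; rewrite !inE; apply: contraNneq ij => eq_lk.
by rewrite inE; apply/exists_inP; exists l; rewrite // !inE eq_lk eq_sym.
Qed.

(** The weights are arbitrary in order to serve twice: task values bound the sum of the utilities,
    and weight 1 counts tasks. *)
Lemma sum_completed_alone (w : 'I_m -> R) p : (forall j, 0 <= w j) ->
  \sum_i \sum_(j in completed_alone i p) w j
    <= \sum_(j in completed [set: 'I_n] p) w j.
Proof.
move=> w_ge0; rewrite -partition_disjoint_bigcup; last first.
  exact: completed_alone_disjoint.
rewrite [leRHS](big_setID (\bigcup_i completed_alone i p)) /=.
rewrite (setIidPr _) ?lerDl ?sumr_ge0 //.
by apply/bigcupsP => i _; exact: subsetDl.
Qed.

Lemma deviate_completed_others i a p :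
  completed [set~ i] (deviate i a p) = completed [set~ i] p.
Proof.
apply/setP => j; rewrite !inE; apply: eq_existsb => k; rewrite !inE ffunE.
by case: (k == i).
Qed.

(** Passing to a minimal action set loses no task: the trajectory that covers [q] stays with it at
    every service time, in particular when [q] serves [j]. *)
Lemma covering_serves i (B : {set trajectory G}) (q : trajectory G) j :
  covering i B -> q \in feasible G i -> serves q j ->
  exists2 a, a \in B & serves a j.
Proof.
case=> _ _ cov Fq qj; have [Bq|nBq] := boolP (q \in B); first by exists q.
have [|a Ba qa] := cov q; first by rewrite inE nBq.
exists a => //; have /existsP[s /[dup] qs /andP[/eqP qloc _]] := qj.
have lt_td : (ta j + s < td j)%N by rewrite -ltn_subRL.
(* Service times live in ['I_T], with [T] the horizon. *)
have lt_T := leq_trans lt_td (departure_le_horizon (tasks G j)).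
apply/existsP; exists s; rewrite -[X in stays _ _ X]qloc.
apply: (qa (Ordinal lt_T)); rewrite inE; apply/existsP; exists j.
by rewrite qs leq_addr.
Qed.

Lemma feasible_one_station i k :
  #|stations G| = 1%N -> feasible G i = feasible G k.
Proof.
move=> /eqP/cards1P[c stE].
have st l : station G l = c by apply/set1P; rewrite -stE station_in.
by apply/setP => q; rewrite !inE !st.
Qed.

Variable A : 'I_n -> {set trajectory G}.
Hypothesis A_covering : forall i, covering i (A i).
Hypothesis one_station : #|stations G| = 1%N.

Lemma profiles_feasible p : p \in profiles A -> p \in feasible_profiles.
Proof.
rewrite !inE => /forallP Ap; apply/forallP => i.
by have [_ /subsetP + _] := A_covering i; apply.
Qed.

Lemma nash_feasible p :
  p \in nash A (@utility _ _ _ G) -> p \in feasible_profiles.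
Proof. by rewrite inE => /andP[/profiles_feasible]. Qed.

Lemma nash_utility_ge p q i j :
  p \in nash A (@utility _ _ _ G) -> q \in feasible_profiles ->
  j \in completed setT q -> j \notin completed setT p ->
  vmax j <= utility i p.
Proof.
rewrite inE => /andP[Ap /forallP/(_ i)/forall_inP p_nash] Fq.
rewrite inE => /exists_inP[k _ kj] pNj.
have Fk : q k \in feasible G i.
  by rewrite (feasible_one_station i k) //; move: Fq; rewrite inE => /forallP.
(* The trajectory [q k] is feasible for [i] but may lie outside [A i]; [a] replaces it. *)
have [a Aa aj] := covering_serves (A_covering i) Fk kj.
apply: le_trans (p_nash a Aa).
have Fdev : deviate i a p \in feasible_profiles.
  apply: profiles_feasible; rewrite !inE in Ap *; apply/forallP => l.
  by rewrite ffunE; case: eqP => [->|_] //; exact: (forallP Ap).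
(* After the deviation, [i] completes [j] alone, since the others left it undone in [p]. *)
rewrite utilityE // (bigD1 j) /=; last first.
  rewrite in_setD deviate_completed_others; apply/andP; split.
    apply: contraNN pNj; exact/subsetP/completed_sub/subsetT.
  by rewrite inE; apply/exists_inP; exists i; rewrite // ffunE eqxx.
by rewrite lerDl sumr_ge0 // => l _; apply/ltW/max_value_gt0.
Qed.

Lemma total_value_ge0 p : p \in feasible_profiles -> 0 <= total_value p.
Proof.
by move=> /total_valueE->; apply: sumr_ge0 => j _; apply/ltW/max_value_gt0.
Qed.

(** Here [q] is any feasible profile, so the bound also compares equilibria with the optimum. *)
Lemma nash_total_value_le p q : (0 < n)%N ->
  p \in nash A (@utility _ _ _ G) -> q \in feasible_profiles ->
  total_value q <= Num.max (m%:R / n%:R) 1 * total_value p.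
Proof.
move=> n_gt0 Np Fq; have Fp := nash_feasible Np.
have v_ge0 j : 0 <= vmax j by apply/ltW/max_value_gt0.
set B := completed setT q :\: completed setT p.
have q_le : total_value q <= total_value p + \sum_(j in B) vmax j.
  rewrite !total_valueE // (big_setID (completed setT p)) /= lerD2r.
  rewrite [leRHS](big_setID (completed setT q)) /= setIC lerDl.
  exact: sumr_ge0.
have B_le i j : j \in B -> vmax j <= utility i p.
  by rewrite in_setD => /andP[pNj qj]; exact: nash_utility_ge Np Fq qj pNj.
have sum_utility : \sum_i utility i p <= total_value p.
  rewrite total_valueE // (eq_bigr _ (fun i _ => utilityE i Fp)).
  exact: sum_completed_alone.
(* If [B] is empty, the factor 1 is enough. Otherwise [j0] makes every utility positive. *)
have [B0|[j0 Bj0]] := set_0Vmem B.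
  rewrite B0 big_set0 addr0 in q_le; apply: le_trans q_le _.
  by rewrite ler_peMl ?total_value_ge0 // le_max lexx orbT.
have n_le : (n + #|B| <= m)%N.
  have : (n <= #|completed setT p|)%N.
    rewrite -(ler_nat R) -sumr_const.
    apply: le_trans (sum_completed_alone (w := fun=> 1) p _) => //.
    rewrite -{1}[n]card_ord -sumr_const; apply: ler_sum => i _.
    (* A robot completing nothing alone would have utility 0, below the value of [j0]. *)
    rewrite sumr_const ler1n card_gt0; apply: contraTneq (B_le i j0 Bj0) => Di0.
    by rewrite utilityE // Di0 big_set0 -ltNge max_value_gt0.
  rewrite -(leq_add2r #|B|) => /leq_trans; apply.
  (* [B] is disjoint from the tasks completed by [p], so the cardinals add up to at most [m]. *)
  rewrite -cardsUI /B setIDA [_ :&: _]setIC -setIDA setDv setI0.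
  rewrite cards0 addn0 -[leqRHS]card_ord.
  exact: max_card.
have nv_le j : j \in B -> n%:R * vmax j <= total_value p.
  move=> Bj; apply: le_trans sum_utility; rewrite mulr_natl.
  have -> : vmax j *+ n = \sum_(i < n) vmax j by rewrite sumr_const card_ord.
  by apply: ler_sum => i _; exact: B_le.
have nR_gt0 : 0 < n%:R :> R by rewrite ltr0n.
apply: (@le_trans _ _ (m%:R / n%:R * total_value p)); last first.
  by rewrite ler_wpM2r ?total_value_ge0 // le_max lexx.
rewrite mulrAC ler_pdivlMr // mulrC.
apply: le_trans (ler_wpM2l (ltW nR_gt0) q_le) _.
apply: (@le_trans _ _ ((n + #|B|)%:R * total_value p)); last first.
  by rewrite ler_wpM2r ?total_value_ge0 // ler_nat.
rewrite mulrDr natrD mulrDl lerD2l mulr_sumr [leRHS]mulr_natl -sumr_const.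
exact: ler_sum.
Qed.

End SimpleTasks.

Theorem theorem3 (R : realType) (n m : nat) (G : dte_system R n m)
    (A : 'I_n -> {set trajectory G})
    (n_gt0 : (0 < n)%N)
    (one_station : #|stations G| = 1%N)
    (all_simple : forall j : 'I_m, simple G j)
    (A_minimal : forall i : 'I_n, minimal_action_set i (A i)) :
  (PoA_dte A <= (Num.max (m%:R / n%:R) 1)%:E)%E.
Proof.
have A_cov i : covering i (A i) by case: (A_minimal i).
have nashF p := @nash_feasible _ _ _ _ _ A_cov p.
apply: price_of_anarchy_le.
- by apply: nash_neq0 => i; case: (A_cov i).
- by rewrite le_max lexx orbT.
- by move=> p /nashF; apply: total_value_ge0.
- move=> p q Np /nashF; exact: nash_total_value_le.
Qed.
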